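(* Let $t,b,k$ be positive integers with $3 \le k \le t$ such that $\ell = bk/(t(t-1))$ is an integer. Under model $(\mathcal{M}1)$, a circular neighbor-balanced design $d^*\in\Omega_{(t,b,k)}$ is universally optimal for the vector of total effects $\phi=\tau+\lambda$ over the class of all designs $d\in\Omega_{(t,b,k)}$ in which no treatment is a neighbor of itself, i.e. $d(i,j)\neq d(i,j-1)$ for all $1\le i\le b$, $1\le j\le k$. That is, $\Phi(C_{d^*}[\phi])\le \Phi(C_d[\phi])$ for every such $d$ and every criterion $\Phi$ in Kiefer's class.
   Context: Designs: there are $t$ treatments labelled $1,\dots,t$ and $b$ linear blocks. Block $i$ has inner plots $j=1,\dots,k$ and two border plots $j=0$ and $j=k+1$. A design $d$ assigns a treatment $d(i,j)$ to each plot $(i,j)$, $0\le j\le k+1$. The design is circular if $d(i,0)=d(i,k)$ and $d(i,k+1)=d(i,1)$ for all $i$. $\Omega_{(t,b,k)}$ denotes the set of all circular designs with $t$ treatments and $b$ blocks of length $k$. Model $(\mathcal{M}1)$: responses $Y_{i,j}$ ($1\le i\le b$, $1\le j\le k$, border plots are not observed) are uncorrelated with common variance and $\mathbb{E}(Y_{i,j})=\beta_i+\tau_{d(i,j)}+\lambda_{d(i,j-1)}$; in vector form $\mathbb{E}(Y)=B\beta+T_d\tau+L_d\lambda$, where $B$ ($bk\times b$) is the block incidence matrix and $T_d$, $L_d$ ($bk\times t$) have in row $(i,j)$ a single $1$ in column $d(i,j)$, resp. $d(i,j-1)$. The total effects are $\phi=\tau+\lambda=K'\alpha$ with $\alpha=(\tau',\lambda')'$,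 $K=\mathbf{1}_2\otimes I_t$. Information matrices: for a matrix $A$, $A^+$ is the Moore–Penrose inverse, $\mathrm{pr}_{(A)}=A(A'A)^+A'$ and $\mathrm{pr}_{(A)}^\perp=I-\mathrm{pr}_{(A)}$. In a model $\mathbb{E}(Y)=A\alpha+B\beta$ with uncorrelated homoscedastic errors, the information matrix for $\alpha$ is $C[\alpha]=A'\mathrm{pr}^\perp_{(B)}A$; for $K'\alpha$ it is $C[K'\alpha]=X_1'\mathrm{pr}^\perp_{(X_2)}X_1$ with $X_1=AK(K'K)^+$, $X_2=(AM\mid B)$, $M=I-K(K'K)^+K'$ (the information for $\theta_1=K'\alpha$ in the reparametrized model $\mathbb{E}(Y)=X_1\theta_1+AM(M\alpha)+B\beta$). $C_d[\phi]$ is this matrix with $A=(T_d\mid L_d)$. Circular neighbor-balanced design (CNBD): a design in $\Omega_{(t,b,k)}$ which is binary (each treatment occurs at most once among the inner plots of each block), is a balanced block design (each treatment occurs on the same number of inner plots and each unordered pair of distinct treatments occurs together in the inner plots of the same number of blocks), and such that for each ordered pair $(a,c)$ of distinct treatments there are exactly $\ell$ inner plots $(i,j)$ with $d(i,j)=a$ and $d(i,j+1)=c$. Universal optimality (Kiefer): $d^*$ is universally optimal over a class $\mathcal{D}$ if $\Phi(C_{d^*})\le\Phi(C_d)$ for all $d\in\mathcal{D}$ and every function $\Phi$ from nonnegative definite symmetric $t\times t$ matrices to $(-\infty,\infty]$ that is convex, satisfies that $\Phi(aC)$ is nonincreasing in the scalar $a\ge0$, and is invariant under simultaneous permutation of rows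 and columns. *)

(* Defs.v *)
From Stdlib Require Import ClassicalEpsilon.
From mathcomp Require Import all_boot all_order all_algebra all_fingroup.
From mathcomp Require Import reals constructive_ereal.
Set Implicit Arguments. Unset Strict Implicit. Unset Printing Implicit Defensive.
Import Order.TTheory GRing.Theory Num.Theory.
Local Open Scope ring_scope.

Section MP.
Variable R : realType.

Definition penrose m n (A : 'M[R]_(m, n)) (X : 'M[R]_(n, m)) : Prop :=
  [/\ A *m X *m A = A, X *m A *m X = X,
      (A *m X)^T = A *m X & (X *m A)^T = X *m A].

(* Moore-Penrose inverse A^+ (it exists and is unique over the reals). *)
Definition mpinv m n (A : 'M[R]_(m, n)) : 'M[R]_(n, m) :=
  epsilon (inhabits 0) (penrose A).

Definition proj m n (A : 'M[R]_(m, n)) : 'M[R]_m := A *m mpinv (A^T *m A) *m A^T.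
Definition projC m n (A : 'M[R]_(m, n)) : 'M[R]_m := 1%:M - proj A.

(* Information matrix for K' alpha in the model E(Y) = A alpha + B beta:
   X1' pr^perp_(X2) X1, X1 = A K (K'K)^+, X2 = (A M | B), M = I - K (K'K)^+ K'. *)
Definition info_lin n s p q (A : 'M[R]_(n, s)) (B : 'M[R]_(n, p))
    (K : 'M[R]_(s, q)) : 'M[R]_q :=
  let X1 := A *m K *m mpinv (K^T *m K) in
  let M := 1%:M - K *m mpinv (K^T *m K) *m K^T in
  let X2 := row_mx (A *m M) B in
  X1^T *m projC X2 *m X1.

End MP.

(* Treatments 1..t are represented by 'I_t, blocks 1..b by 'I_b and plots
   j = 0..k+1 of a block by 'I_k.+2 (0 and k+1 are the border plots). *)
Definition design (t b k : nat) := 'I_b -> 'I_k.+2 -> 'I_t.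

Definition inner k (j : 'I_k.+2) : bool := (1 <= j <= k)%N.

Definition circular t b k (d : design t b k) : Prop :=
  forall i : 'I_b, d i ord0 = d i (inord k) /\ d i ord_max = d i (inord 1).

Definition no_self_neighbor t b k (d : design t b k) : Prop :=
  forall (i : 'I_b) (j : nat), (1 <= j <= k)%N -> d i (inord j) <> d i (inord j.-1).

Lemma blk_proof b k (p : 'I_(b * k)) : (p %/ k < b)%N.
Proof.
case: k p => [|k] p; first by case: p => /= x; rewrite muln0.
by rewrite ltn_divLR.
Qed.

(* observed (inner) plots are numbered p = (i-1) k + (j-1), p : 'I_(b*k) *)
Definition blk b k (p : 'I_(b * k)) : 'I_b := Ordinal (blk_proof p).
Definition pos b k (p : 'I_(b * k)) : 'I_k.+2 := inord (p %% k).+1.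
Definition prv b k (p : 'I_(b * k)) : 'I_k.+2 := inord (p %% k).

Section Matrices.
Variable R : realType.
Variables t b k : nat.

Definition Bmat : 'M[R]_(b * k, b) := \matrix_(p, i) ((blk p == i)%:R).
Definition Tmat (d : design t b k) : 'M[R]_(b * k, t) :=
  \matrix_(p, c) ((d (blk p) (pos p) == c)%:R).
Definition Lmat (d : design t b k) : 'M[R]_(b * k, t) :=
  \matrix_(p, c) ((d (blk p) (prv p) == c)%:R).
Definition Kmat : 'M[R]_(t + t, t) := col_mx 1%:M 1%:M.

Definition Cphi (d : design t b k) : 'M[R]_t :=
  info_lin (row_mx (Tmat d) (Lmat d)) Bmat Kmat.
End Matrices.

Definition binary t b k (d : design t b k) : Prop :=
  forall (i : 'I_b) (j j' : 'I_k.+2), inner j -> inner j' -> d i j = d i j' -> j = j'.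

Definition BBD t b k (d : design t b k) : Prop :=
  (exists r, forall a : 'I_t,
      #|[set x : 'I_b * 'I_k.+2 | inner x.2 && (d x.1 x.2 == a)]| = r) /\
  (exists lam, forall a c : 'I_t, a != c ->
      #|[set i : 'I_b | [exists j : 'I_k.+2, inner j && (d i j == a)] &&
                        [exists j : 'I_k.+2, inner j && (d i j == c)]]| = lam).

Definition neighbor_balanced t b k (l : nat) (d : design t b k) : Prop :=
  forall a c : 'I_t, a != c ->
    #|[set x : 'I_b * 'I_k.+2 | inner x.2 && (d x.1 x.2 == a) &&
                                (d x.1 (inord x.2.+1) == c)]| = l.

Definition CNBD t b k (l : nat) (d : design t b k) : Prop :=
  [/\ circular d, binary d, BBD d & neighbor_balanced l d].

Section Kiefer.
Variable R : realType.
Local Open Scope ereal_scope.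

Definition nnd_sym n (C : 'M[R]_n) : Prop :=
  C^T = C /\ forall v : 'cV[R]_n, (0 <= (v^T *m C *m v) 0 0)%R.

(* Phi : nonnegative definite symmetric t x t matrices -> (-oo, +oo];
   values outside the nnd symmetric matrices are irrelevant. *)
Definition kiefer_criterion n (Phi : 'M[R]_n -> \bar R) : Prop :=
  [/\ (forall C, nnd_sym C -> Phi C != -oo),
      (forall C1 C2 (a : R), nnd_sym C1 -> nnd_sym C2 -> (0 <= a <= 1)%R ->
         Phi (a *: C1 + (1 - a) *: C2)%R <= a%:E * Phi C1 + (1 - a)%:E * Phi C2),
      (forall C (a a' : R), nnd_sym C -> (0 <= a <= a')%R ->
         Phi (a' *: C)%R <= Phi (a *: C)%R) &
      (forall C (s : 'S_n), nnd_sym C ->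
         Phi (\matrix_(i, j) C (s i) (s j)) = Phi C)].

Definition universally_optimal n (D : Type) (info : D -> 'M[R]_n)
    (cls : D -> Prop) (dstar : D) : Prop :=
  forall Phi : 'M[R]_n -> \bar R, kiefer_criterion Phi ->
    forall d, cls d -> Phi (info dstar) <= Phi (info d).
End Kiefer.

(* Main.v *)
(** Project the normalised design matrix Z = (T + L)/2 off the block space only,
    instead of off the block space and the columns of T - L: this can only
    increase the information, and the trace of the resulting matrix is at most
    bk/2 - b, because a circular design has block-treatment counts n_ia with
    sum n_ia^2 >= sum n_ia = bk and because no self-neighbours means tr(T'L) = 0.
    For a CNBD, T'L is symmetric, so T - L is orthogonal to T + L and to the
    blocks: nothing is lost, the trace bound is attained, and the information
    matrix is completely symmetric.  Averaging a competitor's information matrix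
    over all treatment permutations yields a multiple of the same centering
    matrix with no larger factor; convexity, permutation invariance and
    monotonicity of the criterion conclude. *)
From Stdlib Require Import ClassicalEpsilon.
Require Import Defs.
From mathcomp Require Import all_boot all_order all_algebra all_fingroup.
From mathcomp Require Import reals constructive_ereal.
From mathcomp Require Import ring lra zify.
Set Implicit Arguments. Unset Strict Implicit. Unset Printing Implicit Defensive.
Import Order.TTheory GRing.Theory Num.Theory.
Local Open Scope ring_scope.

(** * Gram matrices over an ordered field *)

Section GramMatrices.
Variable R : realFieldType.

Lemma mxtrace_gram m n (A : 'M[R]_(m, n)) :
  \tr (A^T *m A) = \sum_i \sum_j A i j ^+ 2.
Proof.
rewrite exchange_big; apply: eq_bigr => j _; rewrite mxE.
by apply: eq_bigr => i _; rewrite mxE expr2.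
Qed.

Lemma mxtrace_gram_ge0 m n (A : 'M[R]_(m, n)) : 0 <= \tr (A^T *m A).
Proof.
by rewrite mxtrace_gram; do 2![apply: sumr_ge0 => ? _]; rewrite sqr_ge0.
Qed.

Lemma gram_eq0 m n (A : 'M[R]_(m, n)) : A^T *m A = 0 -> A = 0.
Proof.
move=> A0; have := mxtrace_gram A; rewrite A0 mxtrace0 => /esym/eqP.
rewrite psumr_eq0 => [/allP s0|i _]; last by apply: sumr_ge0 => j _; rewrite sqr_ge0.
apply/matrixP=> i j; have /(_ i) := s0; rewrite mem_index_enum => /(_ isT).
rewrite psumr_eq0 => [/allP/(_ j)|j' _]; last by rewrite sqr_ge0.
by rewrite mem_index_enum mxE sqrf_eq0 => /(_ isT)/eqP.
Qed.

Lemma gram_unitmx m n (A : 'M[R]_(m, n)) : row_full A -> A^T *m A \in unitmx.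
Proof.
move=> fA; rewrite -row_free_unit; apply/inj_row_free => v.
move=> vA0; have : (A *m v^T)^T *m (A *m v^T) = 0.
  by rewrite trmx_mul trmxK mulmxA -(mulmxA v) vA0 mul0mx.
move/gram_eq0/(congr1 trmx); rewrite trmx_mul trmxK trmx0 => vAt0.
have : row_free A^T by rewrite -[row_free _]/(\rank _ == n) mxrank_tr.
by move=> /row_free_inj; apply; rewrite vAt0 mul0mx.
Qed.

End GramMatrices.

(** * Moore-Penrose inverses and orthogonal projectors *)

Section MoorePenrose.
Variable R : realType.

(** A full-rank factorisation A = F G makes F'F and G G' invertible, and A^+ = G' (G G')^-1 (F'F)^-1
    F'. *)
Lemma penrose_exists m n (A : 'M[R]_(m, n)) : exists X, penrose A X.
Proof.
have [r [F [G [<- fF fG]]]] : exists r (F : 'M[R]_(m, r)) (G : 'M_(r, n)),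
    [/\ F *m G = A, row_full F & row_free G].
  exists (\rank A), (col_base A), (row_base A).
  by split; [exact: mulmx_base | exact: col_base_full | exact: row_base_free].
set U := F^T *m F; set V := G *m G^T.
have Uu : U \in unitmx by apply: gram_unitmx.
have Vu : V \in unitmx.
  rewrite /V -{1}(trmxK G); apply: gram_unitmx.
  by rewrite /row_full mxrank_tr.
have Ut : U^T = U by rewrite trmx_mul trmxK.
have Vt : V^T = V by rewrite trmx_mul trmxK.
pose X := G^T *m invmx V *m invmx U *m F^T.
have AX : F *m G *m X = F *m invmx U *m F^T.
  by rewrite /X -!mulmxA (mulmxA G) -/V (mulmxA V) mulmxV // mul1mx.
have XA : X *m (F *m G) = G^T *m invmx V *m G.
  by rewrite /X -!mulmxA (mulmxA F^T) -/U (mulmxA (invmx U)) mulVmx // mul1mx.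
exists X; split.
- by rewrite AX -!mulmxA (mulmxA F^T) -/U (mulmxA (invmx U)) mulVmx // mul1mx.
- by rewrite XA /X -!mulmxA (mulmxA G) -/V (mulmxA V) mulmxV // mul1mx.
- by rewrite AX !trmx_mul trmx_inv Ut trmxK mulmxA.
- by rewrite XA !trmx_mul trmx_inv Vt trmxK mulmxA.
Qed.

Lemma mpinvP m n (A : 'M[R]_(m, n)) : penrose A (mpinv A).
Proof. by apply: epsilon_spec; apply: penrose_exists. Qed.

Lemma mpinv_scalar n (a : R) : a != 0 -> mpinv (a%:M : 'M_n) = a^-1%:M.
Proof.
move=> a0; have [+ _ _ _] := mpinvP (a%:M : 'M_n).
rewrite mul_scalar_mx mul_mx_scalar scalerA => /(congr1 ( *:%R (a * a)^-1)).
rewrite scalerA mulVf ?mulf_neq0 // scale1r => ->.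
by rewrite scale_scalar_mx invfM mulfVK.
Qed.

(** The residual Z of this equation satisfies A' Z = 0 by the first Penrose equation, and Z is
    itself A times a matrix, so Z' Z = 0. *)
Lemma proj_mulmx m n (A : 'M[R]_(m, n)) : proj A *m A = A.
Proof.
have [GYG _ _ _] := mpinvP (A^T *m A).
apply/subr0_eq/gram_eq0; rewrite /proj -mulmxA.
set Y := mpinv _ in GYG *; set Z := _ - _.
have AZ : A^T *m Z = 0 by rewrite mulmxBr !mulmxA -(mulmxA _ A^T) GYG subrr.
rewrite [Z^T]linearB /= !trmx_mul trmxK mulmxBl AZ subr0.
by rewrite -!mulmxA AZ !mulmx0.
Qed.

(** Transposing [proj_mulmx] gives P P' = P, whose left side is visibly symmetric. *)
Lemma proj_sym m n (A : 'M[R]_(m, n)) : (proj A)^T = proj A.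
Proof.
have PPt : proj A *m (proj A)^T = proj A.
  rewrite {1}/proj -mulmxA -trmx_mul proj_mulmx //.
by rewrite -PPt trmx_mul trmxK.
Qed.

Lemma proj_idem m n (A : 'M[R]_(m, n)) : proj A *m proj A = proj A.
Proof. by rewrite {2}/proj !mulmxA proj_mulmx. Qed.

Lemma projC_sym m n (A : 'M[R]_(m, n)) : (projC A)^T = projC A.
Proof. by rewrite /projC linearB /= trmx1 proj_sym. Qed.

Lemma projC_idem m n (A : 'M[R]_(m, n)) : projC A *m projC A = projC A.
Proof.
by rewrite {2}/projC mulmxBr mulmx1 {2}/projC mulmxBl mul1mx proj_idem subrr subr0.
Qed.

End MoorePenrose.

(** * Permutation-invariant matrices with zero row sums *)

Section CompletelySymmetric.
Variables (R : realType) (n : nat).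
Implicit Types (C : 'M[R]_n) (s : 'S_n).

Definition perm_conj s C : 'M[R]_n := \matrix_(i, j) C (s i) (s j).

Definition center : 'M[R]_n := 1%:M - const_mx n%:R^-1.

Definition zero_row_sums C := forall i, \sum_j C i j = 0.

(** The first transposition moves i to i'; the second then moves the image of j to j' and fixes
    i'. *)
Lemma perm_pair (i j i' j' : 'I_n) : i != j -> i' != j' ->
  exists s : 'S_n, s i = i' /\ s j = j'.
Proof.
move=> ij ij'; exists (tperm i i' * tperm (tperm i i' j) j')%g.
rewrite !permM tpermL; split; last by rewrite tpermL.
apply: tpermD; last by rewrite eq_sym.
by rewrite -[X in _ != X](tpermL i i') (inj_eq perm_inj) eq_sym.
Qed.

(** Double transitivity of the symmetric group leaves one diagonal and one off-diagonal value; zero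
    row sums fix their ratio and the trace fixes the scale. *)
Lemma completely_symmetric_center C :
  (1 < n)%N -> (forall s, perm_conj s C = C) -> zero_row_sums C ->
  C = (\tr C / (n%:R - 1)) *: center.
Proof.
move=> n1 Cs C0; pose i0 : 'I_n := Ordinal (ltnW n1); pose i1 : 'I_n := Ordinal n1.
have i01 : i0 != i1 by [].
have Cd i : C i i = C i0 i0.
  by rewrite -[in RHS](Cs (tperm i0 i)) mxE tpermL.
have Co i j : i != j -> C i j = C i0 i1.
  move=> ij; have [s [s0 s1]] := perm_pair i01 ij.
  by rewrite -[in RHS](Cs s) mxE s0 s1.
have n1R : n%:R - 1 != 0 :> R by rewrite subr_eq0 pnatr_eq1 gtn_eqF.
have nR : n%:R != 0 :> R by rewrite pnatr_eq0 -lt0n ltnW.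
have trC : \tr C = n%:R * C i0 i0.
  rewrite /mxtrace (eq_bigr (fun=> C i0 i0)) => [|i _]; last exact: Cd.
  by rewrite sumr_const card_ord mulr_natl.
have off : C i0 i1 * (n%:R - 1) = - C i0 i0.
  have := C0 i0; rewrite (bigD1 i0) //= (eq_bigr (fun=> C i0 i1)); last first.
    by move=> j j0; apply: Co; rewrite eq_sym.
  rewrite sumr_const cardC1 card_ord -subn1 -[_ *+ _]mulr_natr natrB ?(ltnW n1) //.
  by move/eqP; rewrite addrC addr_eq0 => /eqP.
apply/matrixP=> i j; rewrite !mxE trC; have [<-|ij] := eqVneq i j.
  by rewrite Cd mulr1n; field; rewrite nR.
apply: (mulIf n1R); rewrite Co // off mulr0n; field; by rewrite nR.
Qed.

End CompletelySymmetric.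

(** * Closure properties of nonnegative definite matrices *)

Section NonnegativeDefinite.
Variables (R : realType) (n : nat).
Implicit Types (C : 'M[R]_n) (s : 'S_n).

Lemma nnd_gram m (A : 'M[R]_(m, n)) : nnd_sym (A^T *m A).
Proof.
split=> [|v]; first by rewrite trmx_mul trmxK.
rewrite mulmxA -trmx_mul -mulmxA -trace_mx11; exact: mxtrace_gram_ge0.
Qed.

Lemma nndD C1 C2 : nnd_sym C1 -> nnd_sym C2 -> nnd_sym (C1 + C2).
Proof.
move=> [s1 p1] [s2 p2]; split=> [|v]; first by rewrite linearD /= s1 s2.
by rewrite mulmxDr mulmxDl mxE addr_ge0.
Qed.

Lemma nndZ (a : R) C : 0 <= a -> nnd_sym C -> nnd_sym (a *: C).
Proof.
move=> a0 [s1 p1]; split=> [|v]; first by rewrite linearZ /= s1.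
by rewrite -scalemxAr -scalemxAl mxE mulr_ge0.
Qed.

Lemma nnd_perm_conj s C : nnd_sym C -> nnd_sym (perm_conj s C).
Proof.
move=> [Ct Cp]; split=> [|v].
  by apply/matrixP=> i j; rewrite !mxE -[in LHS]Ct mxE.
have := Cp (\col_i v ((s^-1)%g i) 0).
congr (0 <= _); rewrite !mxE (reindex_inj (@perm_inj _ s)) /=.
apply: eq_bigr => j _; rewrite !mxE permK; congr (_ * _).
rewrite (reindex_inj (@perm_inj _ s)) /=.
by apply: eq_bigr => i _; rewrite !mxE permK.
Qed.

Lemma trmx_center : (center R n)^T = center R n.
Proof. by rewrite linearB /= trmx1 trmx_const. Qed.

Lemma nnd_center : (0 < n)%N -> nnd_sym (center R n).
Proof.
move=> n0; suff <- : (center R n)^T *m center R n = center R n by apply: nnd_gram.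
rewrite trmx_center mulmxBr mulmx1 mulmxBl mul1mx.
set J : 'M[R]_n := const_mx _; suff -> : J *m J = J.
  by rewrite subrr subr0.
apply/matrixP=> i j; rewrite !mxE (eq_bigr (fun=> n%:R^-1 * n%:R^-1)) => [|l _].
  rewrite sumr_const card_ord -[_ *+ n]mulr_natr mulfVK //.
  by rewrite pnatr_eq0 -lt0n.
by rewrite !mxE.
Qed.

End NonnegativeDefinite.

(** * Kiefer criteria and averaging over permutations *)

Section Kiefer.
Variables (R : realType) (n : nat) (Phi : 'M[R]_n -> \bar R).
Hypothesis KPhi : kiefer_criterion Phi.
Implicit Types (C : 'M[R]_n) (s : 'S_n).

(** Jensen's inequality for uniform weights, by induction: a mean of m+1 terms is the convex
    combination, with weight 1/(m+1), of its first term and the mean of the other m. *)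
Lemma kiefer_mean (I : eqType) (F : I -> 'M[R]_n) (r : seq I) (x : \bar R) :
  (forall i, nnd_sym (F i)) -> (forall i, Phi (F i) = x) -> r != [::] ->
  (Phi ((size r)%:R^-1 *: \sum_(i <- r) F i)%R <= x)%E.
Proof.
have [Pfin Pconv _ _] := KPhi; move=> Fn Fx.
case: r => // i r _; elim: r i => [|j r IHr] i.
  by rewrite big_seq1 /= invr1 scale1r Fx.
have Sn : nnd_sym ((size (j :: r))%:R^-1 *: \sum_(i <- j :: r) F i).
  apply: nndZ; first by rewrite invr_ge0 ler0n.
  elim: (j :: r) => [|l r' IH]; last by rewrite big_cons; apply: nndD.
  rewrite big_nil; have := @nnd_gram R n 0 0; by rewrite mulmx0.
set m := size (j :: r) in IHr Sn *.
have m0 : (m%:R : R) != 0 by rewrite pnatr_eq0.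
rewrite -[size _]/m.+1; have m1 : (m.+1%:R : R) != 0 by rewrite pnatr_eq0.
have -> : m.+1%:R^-1 *: \sum_(i <- i :: j :: r) F i =
  m.+1%:R^-1 *: F i + (1 - m.+1%:R^-1) *: (m%:R^-1 *: \sum_(i <- j :: r) F i).
  rewrite big_cons scalerDr scalerA; congr (_ + _ *: _).
  by move: m1; rewrite -natr1 => m1; field; rewrite m0 m1.
set a : R := _^-1.
have a01 : 0 <= a <= 1 by rewrite invr_ge0 ler0n invf_le1 ?ltr0n // ler1n.
apply: (Order.POrderTheory.le_trans (Pconv _ _ a (Fn i) Sn a01)).
have := IHr j; rewrite -/m Fx; have := Pfin _ (Fn i); rewrite Fx.
have := Pfin _ Sn.
have [a0 a1] := andP a01.
(* The case x = +oo is trivial and x = -oo is excluded; for real x the induction bound forces a real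
   value at the shorter mean. *)
case: x {Fx IHr} => [x||] SN xN; [|by move=> _; rewrite leey|by []].
case: (Phi _) SN => [y||] //= _.
rewrite !lee_fin => yx; nra.
Qed.

(** The left-hand matrix is the average of C over all simultaneous permutations: averaging keeps the
    trace and the zero row sums and makes the matrix permutation-invariant. *)
Lemma kiefer_center C :
  (1 < n)%N -> nnd_sym C -> zero_row_sums C ->
  (Phi ((\tr C / (n%:R - 1)) *: center R n)%R <= Phi C)%E.
Proof.
move=> n1 Cn C0; have [_ _ _ Pperm] := KPhi.
pose r := index_enum {perm 'I_n}.
pose M := (size r)%:R^-1 *: \sum_(s <- r) perm_conj s C.
have r0 : r != [::].
  by apply/eqP => r0; have := mem_index_enum (1%g : 'S_n); rewrite -/r r0.
have rR : (size r)%:R != 0 :> R by rewrite pnatr_eq0; case: (r) r0.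
have trM : \tr M = \tr C.
  rewrite /M mxtraceZ raddf_sum /= (eq_bigr (fun=> \tr C)) => [|s _].
    by rewrite big_const_seq count_predT iter_addr addr0 -[\tr C *+ _]mulr_natl mulKf.
  rewrite /mxtrace [in RHS](reindex_inj (@perm_inj _ s)) /=.
  by apply: eq_bigr => i _; rewrite mxE.
have ME i j : M i j = (size r)%:R^-1 * \sum_(s <- r) C (s i) (s j).
  by rewrite mxE summxE; congr (_ * _); apply: eq_bigr => s _; rewrite mxE.
have Ms s : perm_conj s M = M.
  apply/matrixP=> i j; rewrite mxE !ME; congr (_ * _).
  rewrite [in RHS](reindex_inj (mulgI s)) /=.
  by apply: eq_bigr => s' _; rewrite !permM.
have M0 : zero_row_sums M.
  move=> i; under eq_bigr do rewrite ME; rewrite -mulr_sumr exchange_big /=.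
  rewrite big1 ?mulr0 // => s _; rewrite -[RHS](C0 (s i)).
  by rewrite [in RHS](reindex_inj (@perm_inj _ s)).
rewrite -trM -completely_symmetric_center //.
apply: kiefer_mean => // s; [exact: nnd_perm_conj | exact: Pperm].
Qed.

Lemma kiefer_le C D :
  (1 < n)%N -> nnd_sym C -> zero_row_sums C -> zero_row_sums D ->
  (forall s, perm_conj s D = D) -> \tr C <= \tr D -> (Phi D <= Phi C)%E.
Proof.
move=> n1 Cn C0 D0 Ds CD; have [_ _ Pmono _] := KPhi.
rewrite (completely_symmetric_center n1 Ds D0).
apply: Order.POrderTheory.le_trans (kiefer_center n1 Cn C0).
have n10 : 0 < n%:R - 1 :> R by rewrite subr_gt0 ltr1n.
apply: Pmono; first exact/nnd_center/ltnW.
rewrite divr_ge0 ?(ltW n10) ?ler_pM2r ?invr_gt0 //=.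
rewrite /mxtrace sumr_ge0 // => i _.
(* Diagonal entries are values of the quadratic form at unit vectors, so the smaller scalar, built
   from the trace of C, is nonnegative as monotonicity demands. *)
have [_ /(_ (delta_mx i 0))] := Cn.
by rewrite trmx_delta -rowE -colE !mxE.
Qed.

End Kiefer.

(** * Information after eliminating nuisance columns N and blocks B *)

Section Information.
Variables (R : realType) (m n p q : nat).
Variables (Z : 'M[R]_(m, n)) (N : 'M[R]_(m, p)) (B : 'M[R]_(m, q)) (c : R).
Hypotheses (c0 : c != 0) (BtB : B^T *m B = c%:M).
Let X := row_mx N B.
(** Since B'B = c I, this is the orthogonal projector onto the column space of B. *)
Let Q := c^-1 *: (B *m B^T).

Lemma proj_row_mx : proj X *m B = B.
Proof. by have := proj_mulmx X; rewrite mul_mx_row => /eq_row_mx[]. Qed.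

Lemma projC_row_mx : projC X *m B = 0.
Proof. by rewrite /projC mulmxBl mul1mx proj_row_mx subrr. Qed.

Let PQ : proj X *m Q = Q.
Proof. by rewrite -scalemxAr mulmxA proj_row_mx. Qed.

Let Qt : Q^T = Q.
Proof. by rewrite linearZ /= trmx_mul trmxK. Qed.

Let QB : Q *m B = B.
Proof. by rewrite -scalemxAl -mulmxA BtB mul_mx_scalar scalerA mulVf // scale1r. Qed.

Let QQ : Q *m Q = Q.
Proof. by rewrite {2}/Q -scalemxAr mulmxA QB. Qed.

Let QP : Q *m proj X = Q.
Proof. by rewrite -{1}Qt -{1}(proj_sym X) -trmx_mul PQ Qt. Qed.

Let ZQZ : Z^T *m Q *m Z = c^-1 *: ((B^T *m Z)^T *m (B^T *m Z)).
Proof. by rewrite -scalemxAr -scalemxAl trmx_mul trmxK !mulmxA. Qed.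

(** The columns of B lie among those of X, so W = pr_X - Q is again an orthogonal projector, and the
    two sides differ by the trace of (W Z)'(W Z). *)
Lemma mxtrace_info_le : \tr (Z^T *m projC X *m Z) <=
  \tr (Z^T *m Z) - c^-1 * \tr ((B^T *m Z)^T *m (B^T *m Z)).
Proof.
pose W := proj X - Q.
have WW : W^T *m W = W.
  have -> : W^T = W by rewrite linearB /= proj_sym Qt.
  by rewrite mulmxBr !mulmxBl proj_idem PQ QQ QP subrr subr0.
have := mxtrace_gram_ge0 (W *m Z).
have -> : (W *m Z)^T *m (W *m Z) = Z^T *m proj X *m Z - Z^T *m Q *m Z.
  by rewrite trmx_mul mulmxA -(mulmxA _ W^T) WW mulmxBr mulmxBl.
rewrite (raddfB (@mxtrace R n)) /= subr_ge0 /projC mulmxBr mulmx1 mulmxBl.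
by rewrite raddfB /= ZQZ mxtraceZ lerD2l lerN2.
Qed.

(** Z - Q Z is orthogonal to both N and B, hence killed by pr_X; so pr_X Z = Q Z and eliminating N
    costs nothing beyond B. *)
Lemma info_orthogonal : N^T *m Z = 0 -> N^T *m B = 0 ->
  Z^T *m projC X *m Z = Z^T *m Z - c^-1 *: ((B^T *m Z)^T *m (B^T *m Z)).
Proof.
move=> NZ NB.
have XZ : X^T *m (Z - Q *m Z) = 0.
  have NQ : N^T *m Q = 0 by rewrite -scalemxAr mulmxA NB mul0mx scaler0.
  have BQ : B^T *m Q = B^T by rewrite -{1}Qt -trmx_mul QB.
  rewrite tr_row_mx mul_col_mx !mulmxBr NZ (mulmxA _ Q) NQ (mulmxA _ Q) BQ.
  by rewrite mul0mx !subrr col_mx0.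
have : proj X *m (Z - Q *m Z) = 0 by rewrite /proj -mulmxA XZ mulmx0.
rewrite mulmxBr (mulmxA (proj X) Q) PQ => /subr0_eq PZ.
rewrite /projC mulmxBr mulmx1 mulmxBl -ZQZ; congr (_ - _).
by rewrite -(mulmxA _ (proj X)) PZ mulmxA.
Qed.

End Information.

(** * Sums and counts over plots *)

Section Plots.
Variables (b k : nat).

(** Euclidean division by k is a bijection from plot numbers to pairs of a block and a position
    counted from 0. *)
Lemma sum_plots (V : nmodType) (F : 'I_b -> nat -> V) :
  \sum_(p < b * k) F (blk p) (p %% k)%N = \sum_i \sum_(j < k) F i j.
Proof.
case: k => [|k'] in F *.
  rewrite [RHS]big1 => [|i _]; last by rewrite big_ord0.
  by apply: big1 => -[p lt_p] _; exfalso; move: lt_p; rewrite muln0.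
rewrite pair_big /=.
have lt_plot (x : 'I_b * 'I_k'.+1) : (x.1 * k'.+1 + x.2 < b * k'.+1)%N.
  by case: x => i j /=; have := ltn_ord i; have := ltn_ord j; nia.
pose h x : 'I_(b * k'.+1) := Ordinal (lt_plot x).
pose g (p : 'I_(b * k'.+1)) : 'I_b * 'I_k'.+1 := (blk p, inord (p %% k'.+1)).
have blkh x : blk (h x) = x.1.
  by apply: val_inj; rewrite /= divnMDl // divn_small ?addn0.
have modh x : (h x %% k'.+1)%N = x.2 by rewrite /= modnMDl modn_small.
rewrite (reindex h) /=.
  by apply: eq_bigr => x _; rewrite blkh [(_ %% _)%N]modh.
exists g => x _; first by rewrite /g blkh modh inord_val; case: x.
by apply: val_inj; rewrite /= inordK ?ltn_mod // -divn_eq.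
Qed.

(** This is how circularity enters sums: left neighbours run over positions 0 to k-1, the plots
    themselves over 1 to k. *)
Lemma sum_cyclic (V : nmodType) (f : nat -> V) :
  f 0%N = f k -> \sum_(j < k) f j = \sum_(j < k) f j.+1.
Proof.
case: k => [|k'] f0; first by rewrite !big_ord0.
by rewrite big_ord_recl big_ord_recr /= f0 addrC.
Qed.

Lemma card_inner (P : 'I_b -> 'I_k.+2 -> bool) :
  #|[set x : 'I_b * 'I_k.+2 | inner x.2 && P x.1 x.2]|
    = (\sum_i \sum_(j < k) P i (inord j.+1))%N.
Proof.
rewrite -sum1dep_card big_mkcondr /= -(pair_big_dep xpredT (fun _ j => inner j)
  (fun i j => if P i j then 1%N else 0%N)) /=.
(* The border plots 0 and k+1 are split off and contribute 0; index j of the remaining sum is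
   position j+1. *)
apply: eq_bigr => i _; rewrite big_mkcond big_ord_recl big_ord_recr /= /inner /=.
rewrite /bump /= ltnn add0n addn0; apply: eq_bigr => j _.
rewrite !add1n /= ltn_ord (_ : inord j.+1 = lift ord0 (widen_ord (leqnSn k) j)).
  by case: (P i _).
by apply: val_inj; rewrite /= inordK // ltnS ltnW // ltnS.
Qed.

End Plots.

(** * Information matrix of a general design and its trace bound *)

Section Designs.
Variables (R : realType) (t b k : nat).
Hypothesis k_gt0 : (0 < k)%N.
Implicit Types (d : design t b k) (i : 'I_b) (a c : 'I_t).

Local Notation B := (Bmat R b k).
Local Notation T := (Tmat R).
Local Notation L := (Lmat R).

(** This is X1 = A K (K'K)^+, because K'K = 2 I. *)
Definition half_TL d : 'M[R]_(b * k, t) := 2^-1 *: (T d + L d).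

Definition incidence d : 'M[R]_(b, t) :=
  \matrix_(i, a) \sum_(j < k) (d i (inord j.+1) == a)%:R.

Lemma Cphi_half_TL d : Cphi R d = (half_TL d)^T *m
  projC (row_mx (row_mx (T d - half_TL d) (L d - half_TL d)) B) *m half_TL d.
Proof.
have two0 : 2 != 0 :> R by rewrite pnatr_eq0.
have KK : (Kmat R t)^T *m Kmat R t = 2%:M.
  by rewrite /Kmat tr_col_mx mul_row_col trmx1 mulmx1 -[2]/(1 + 1) raddfD.
have AK : row_mx (T d) (L d) *m Kmat R t = T d + L d.
  by rewrite /Kmat mul_row_col !mulmx1.
have AM : row_mx (T d) (L d) *m (1%:M - (2^-1 *: Kmat R t) *m (Kmat R t)^T) =
    row_mx (T d - half_TL d) (L d - half_TL d).
  rewrite mulmxBr mulmx1 mulmxA -scalemxAr AK -/(half_TL d).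
  by rewrite /Kmat tr_col_mx trmx1 mul_mx_row mulmx1 opp_row_mx add_row_mx.
by rewrite /Cphi /info_lin KK mpinv_scalar // AK !mul_mx_scalar AM.
Qed.

Lemma Bmat_gram : B^T *m B = k%:R%:M.
Proof.
apply/matrixP=> i i'; rewrite !mxE.
under eq_bigr do rewrite !mxE.
rewrite (sum_plots k (fun x _ => (x == i)%:R * (x == i')%:R : R)) /=.
under eq_bigr do rewrite sumr_const card_ord.
rewrite (bigD1 i) //= eqxx mul1r big1 ?addr0 => [|x /negbTE->]; last first.
  by rewrite mul0r mul0rn.
by case: eqP => _; rewrite ?mul0rn.
Qed.

Lemma Bt_Tmat d : B^T *m T d = incidence d.
Proof.
apply/matrixP=> i a; rewrite !mxE.
under eq_bigr do rewrite !mxE.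
rewrite (sum_plots k (fun x j => (x == i)%:R * (d x (inord j.+1) == a)%:R : R)).
rewrite (bigD1 i) //= [X in _ + X]big1 ?addr0 => [|x /negbTE xi].
  by apply: eq_bigr => j _; rewrite eqxx mul1r.
by apply: big1 => j _; rewrite xi mul0r.
Qed.

(** Within a circular block the left neighbours of the inner plots carry the same treatments, with
    multiplicity, as the inner plots. *)
Lemma Bt_Lmat d : circular d -> B^T *m L d = incidence d.
Proof.
move=> dc; apply/matrixP=> i a; rewrite !mxE.
under eq_bigr do rewrite !mxE.
rewrite (sum_plots k (fun x j => (x == i)%:R * (d x (inord j) == a)%:R : R)).
rewrite (bigD1 i) //= [X in _ + X]big1 ?addr0 => [|x /negbTE xi]; last first.
  by apply: big1 => j _; rewrite xi mul0r.
rewrite -(sum_cyclic (f := fun j => (d i (inord j) == a)%:R)).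
  by apply: eq_bigr => j _; rewrite eqxx mul1r.
by have [<- _] := dc i; rewrite (_ : inord 0 = ord0) //; apply: val_inj; rewrite /= inordK.
Qed.

Lemma Bt_half_TL d : circular d -> B^T *m half_TL d = incidence d.
Proof.
move=> dc; rewrite -scalemxAr mulmxDr Bt_Tmat Bt_Lmat // -mulr2n -scaler_nat.
by rewrite scalerA mulVf ?scale1r // pnatr_eq0.
Qed.

Lemma nnd_Cphi d : nnd_sym (Cphi R d).
Proof.
rewrite Cphi_half_TL -projC_idem -{1}projC_sym !mulmxA -trmx_mul -mulmxA.
exact: nnd_gram.
Qed.

(** Every row of [half_TL] and of B sums to 1, so [half_TL] maps the all-ones vector into the block
    space, which the complementary projector kills. *)
Lemma Cphi_zero_row_sums d : zero_row_sums (Cphi R d).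
Proof.
have two0 : 2 != 0 :> R by rewrite pnatr_eq0.
have e1 n (x : 'I_n) : \sum_(a < n) (x == a)%:R = 1%:R :> R.
  by rewrite (bigD1 x) //= eqxx big1 ?addr0 // => a; rewrite eq_sym => /negbTE->.
have XB : half_TL d *m const_mx 1 = B *m const_mx 1 :> 'cV_(b * k).
  apply/matrixP=> p z; rewrite !mxE.
  under eq_bigr do rewrite !mxE mulr1; rewrite -mulr_sumr big_split /=.
  under [in RHS]eq_bigr do rewrite !mxE mulr1.
  by rewrite !e1 // -[1%:R + _]/(2 : R) mulVf.
have C1 : Cphi R d *m const_mx 1 = 0 :> 'cV_t.
  rewrite Cphi_half_TL -mulmxA XB mulmxA -[_ *m projC _ *m _]mulmxA.
  by rewrite projC_row_mx mulmx0 mul0mx.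
move=> a; have /matrixP/(_ a 0) := C1; rewrite !mxE => Ca0; rewrite -[RHS]Ca0.
by apply: eq_bigr => c _; rewrite [const_mx _ _ _]mxE mulr1.
Qed.

(** Without self-neighbours each row has exactly two nonzero entries, both 1/2, so its squares sum
    to 1/2. *)
Lemma mxtrace_half_TL d : no_self_neighbor d ->
  \tr ((half_TL d)^T *m half_TL d) = (b * k)%:R / 2.
Proof.
move=> dn; rewrite mxtrace_gram (eq_bigr (fun=> 2^-1)) => [|p _].
  by rewrite sumr_const card_ord mulr_natl.
set x := d (blk p) (pos p); set y := d (blk p) (prv p).
have xy : x != y.
  apply/eqP; have := dn (blk p) (p %% k).+1; rewrite /= ltn_mod; exact.
rewrite (bigD1 x) //= (bigD1 y) 1?eq_sym //= !mxE -/x -/y !eqxx.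
rewrite (negbTE xy) eq_sym (negbTE xy) big1 => [|a /andP[]].
  by rewrite /= add0r !addr0 mulr1; field.
rewrite !mxE -/x -/y eq_sym => /negbTE->; rewrite eq_sym => /negbTE->.
by rewrite addr0 mulr0 expr0n.
Qed.

Lemma incidence_nat d i a :
  incidence d i a = (\sum_(j < k) (d i (inord j.+1) == a))%:R.
Proof. by rewrite mxE natr_sum. Qed.

Lemma sum_incidence d : \sum_i \sum_a incidence d i a = (b * k)%:R.
Proof.
rewrite (eq_bigr (fun=> k%:R)) => [|i _].
  by rewrite sumr_const card_ord natrM mulr_natl.
under eq_bigr do rewrite mxE.
rewrite exchange_big /= (eq_bigr (fun=> 1)) => [|j _].
  by rewrite sumr_const card_ord.
rewrite (bigD1 (d i (inord j.+1))) //= eqxx big1 ?addr0 // => a.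
by rewrite eq_sym => /negbTE->.
Qed.

(** The block-treatment counts are natural numbers n, for which n <= n^2. *)
Lemma mxtrace_incidence_ge d :
  (b * k)%:R <= \tr ((incidence d)^T *m incidence d).
Proof.
rewrite mxtrace_gram -(sum_incidence d).
apply: ler_sum => i _; apply: ler_sum => a _.
by rewrite incidence_nat -natrX ler_nat; case: (\sum_(_ < _) _)%N => // n; nia.
Qed.

Lemma mxtrace_Cphi_le d : circular d -> no_self_neighbor d ->
  \tr (Cphi R d) <= (b * k)%:R / 2 - k%:R^-1 * (b * k)%:R.
Proof.
move=> dc dn; have k0 : k%:R != 0 :> R by rewrite pnatr_eq0 -lt0n.
rewrite Cphi_half_TL.
apply: le_trans (mxtrace_info_le _ _ k0 Bmat_gram) _.
rewrite Bt_half_TL // mxtrace_half_TL // lerD2l lerN2.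
by rewrite ler_wpM2l ?mxtrace_incidence_ge // invr_ge0.
Qed.

End Designs.

(** * Information matrix of a circular neighbor-balanced design *)

Section NeighborBalanced.
Variables (R : realType) (t b k l : nat) (d : design t b k).
Hypotheses (k_gt1 : (1 < k)%N) (dC : CNBD l d).
Implicit Types (i : 'I_b) (a c : 'I_t).

Let k_gt0 : (0 < k)%N := ltnW k_gt1.

Local Notation B := (Bmat R b k).
Local Notation T := (Tmat R d).
Local Notation L := (Lmat R d).
Local Notation N := (incidence R d).

Let dcirc : circular d. Proof. by case: dC. Qed.

Lemma inner_inord j : (0 < j <= k)%N -> inner (inord j : 'I_k.+2).
Proof. by case/andP=> j0 jk; rewrite /inner inordK ?j0 // !ltnS ltnW. Qed.

Lemma circular_wrap i : d i (inord 0) = d i (inord k) /\ d i (inord k.+1) = d i (inord 1).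
Proof.
have [<- <-] := dcirc i; split; congr (d i _); apply: val_inj.
  by rewrite /= inordK.
by rewrite /= inordK.
Qed.

(** Neighbours both inside the block differ by binarity; the left border plot copies plot k, which
    differs from plot 1 since k > 1. *)
Lemma CNBD_no_self_neighbor : no_self_neighbor d.
Proof.
have [_ dbin _ _] := dC.
move=> i [//|[_|j /andP[_ jk]]] /= dE.
  have [d0 _] := circular_wrap i; rewrite d0 in dE.
  have k_in : (0 < k <= k)%N by rewrite k_gt0 /=.
  have one_in : (0 < 1 <= k)%N by [].
  have := dbin _ _ _ (inner_inord one_in) (inner_inord k_in) dE.
  by move/(congr1 val); rewrite /= !inordK //; lia.
have j_in : (0 < j.+1 <= k)%N by apply: ltnW.
have j1_in : (0 < j.+2 <= k)%N by [].
have := dbin _ _ _ (inner_inord j1_in) (inner_inord j_in) dE.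
by move/(congr1 val); rewrite /= !inordK //; lia.
Qed.

Lemma Tt_T a c : (T^T *m T) a c =
  \sum_i \sum_(j < k) ((d i (inord j.+1) == a) && (d i (inord j.+1) == c))%:R.
Proof.
rewrite mxE; under eq_bigr do rewrite !mxE -natrM mulnb.
exact: (sum_plots k (fun i j =>
  ((d i (inord j.+1) == a) && (d i (inord j.+1) == c))%:R)).
Qed.

Lemma Lt_L : L^T *m L = T^T *m T.
Proof.
apply/matrixP=> a c; rewrite Tt_T mxE.
under eq_bigr do rewrite !mxE -natrM mulnb.
rewrite (sum_plots k (fun i j => ((d i (inord j) == a) && (d i (inord j) == c))%:R)).
apply: eq_bigr => i _.
rewrite (sum_cyclic (f := fun j => ((d i (inord j) == a) && (d i (inord j) == c))%:R)) //.
by have [-> _] := circular_wrap i.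
Qed.

Lemma Tt_T_scalar : exists r : R, T^T *m T = r%:M /\
  forall a, \sum_i N i a = r.
Proof.
have [_ _ [[r dr] _] _] := dC.
have Nr a : \sum_i \sum_(j < k) (d i (inord j.+1) == a)%:R = r%:R :> R.
  rewrite -(dr a) (card_inner (fun i j => d i j == a)) natr_sum.
  by apply: eq_bigr => i _; rewrite natr_sum.
exists r%:R; split; last by move=> a; rewrite -(Nr a); apply: eq_bigr => i _; rewrite mxE.
apply/matrixP=> a c; rewrite Tt_T !mxE; have [<-|ac] := eqVneq a c.
  by rewrite mulr1n -(Nr a); apply: eq_bigr => i _; apply: eq_bigr => j _; rewrite andbb.
rewrite big1 // => i _; rewrite big1 // => j _.
by case: eqP => // ->; rewrite (negbTE ac).
Qed.

(** Entry (a, c) counts inner plots carrying a with left neighbour c: zero on the diagonal, as there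
    are no self-neighbours, and l elsewhere by neighbor balance. *)
Lemma Tt_L : T^T *m L = const_mx l%:R - l%:R%:M.
Proof.
have [_ _ _ dl] := dC.
apply/matrixP=> a c; rewrite !mxE; under eq_bigr do rewrite !mxE -natrM mulnb.
rewrite (sum_plots k (fun i j => ((d i (inord j.+1) == a) && (d i (inord j) == c))%:R)).
have [<-|ac] := eqVneq a c.
  rewrite mulr1n subrr big1 // => i _; rewrite big1 // => j _.
  case: eqP => // <-; case: eqP => // /esym.
  by move/(@CNBD_no_self_neighbor i j.+1 (ltn_ord j)).
(* Balance is stated through right neighbours, so the relevant ordered pair is (c, a). *)
rewrite mulr0n subr0 -(dl c a) 1?eq_sym //.
transitivity (#|[set x : 'I_b * 'I_k.+2 | inner x.2 &&
   ((d x.1 x.2 == c) && (d x.1 (inord x.2.+1) == a))]|%:R : R); last first.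
  by congr _%:R; apply: eq_card => x; rewrite !inE andbA.
rewrite (card_inner (fun i j => (d i j == c) && (d i (inord j.+1) == a))) natr_sum.
apply: eq_bigr => i _; rewrite natr_sum.
(* Shifting by one plot turns pairs (j, j+1) with j from 0 to k-1 into those with j from 1 to k. *)
rewrite (sum_cyclic (f := fun j => ((d i (inord j.+1) == a) && (d i (inord j) == c))%:R)).
  by apply: eq_bigr => j _; rewrite andbC inordK // !ltnS ltnW.
by have [-> ->] := circular_wrap i.
Qed.

Lemma Lt_T : L^T *m T = T^T *m L.
Proof.
rewrite -[LHS]trmxK trmx_mul trmxK Tt_L linearB /=.
by rewrite trmx_const tr_scalar_mx.
Qed.

Lemma incidence_binary i a :
  N i a = [exists j : 'I_k.+2, inner j && (d i j == a)]%:R.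
Proof.
have [_ dbin _ _] := dC.
rewrite mxE; case: existsP => [[j0 /andP[j0in /eqP dj0]]|nex]; last first.
  apply: big1 => j _; case: eqP => // dj; case: nex; exists (inord j.+1).
  by rewrite inner_inord ?dj ?eqxx // ltn_ord.
have j0k : (j0.-1 < k)%N by move: j0in; rewrite /inner; lia.
have j0E : inord j0.-1.+1 = j0.
  by rewrite prednK ?inord_val //; case/andP: j0in.
rewrite (bigD1 (Ordinal j0k)) //= j0E dj0 eqxx big1 ?addr0 // => j jj0.
case: eqP => // dj; case/eqP: jj0; apply: val_inj => /=.
have jin : (0 < j.+1 <= k)%N by rewrite ltn_ord.
have := dbin i _ _ (inner_inord jin) j0in; rewrite dj dj0 => /(_ erefl) <-.
by rewrite inordK // !ltnS ltnW.
Qed.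

Lemma incidence_idem i a : N i a ^+ 2 = N i a.
Proof. by rewrite incidence_binary; case: [exists _, _]; rewrite ?expr1n ?expr0n. Qed.

(** Counts are 0 or 1, so diagonal entries are replication numbers and off-diagonal entries are
    concurrence numbers; both are constant by balance. *)
Lemma incidence_gram : exists x y : R, N^T *m N = x%:M + const_mx y.
Proof.
have [_ _ [_ [lam dlam]] _] := dC; have [r [_ Nr]] := Tt_T_scalar.
exists (r - lam%:R), lam%:R; apply/matrixP=> a c; rewrite !mxE.
have [<-|ac] := eqVneq a c.
  rewrite mulr1n subrK -(Nr a); apply: eq_bigr => i _.
  by rewrite mxE -expr2 incidence_idem.
rewrite add0r -(dlam a c ac) -sum1dep_card natr_sum [RHS]big_mkcond /=.
apply: eq_bigr => i _; rewrite mxE !incidence_binary -natrM mulnb.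
by case: ifP.
Qed.

(** The nuisance columns are multiples of T - L, orthogonal to T + L because T'T = L'L and T'L =
    L'T, and to B because B'T = B'L. *)
Lemma Cphi_CNBD : Cphi R d =
  (half_TL R d)^T *m half_TL R d - k%:R^-1 *: (N^T *m N).
Proof.
have k0 : k%:R != 0 :> R by rewrite pnatr_eq0 -lt0n.
have TB : T - half_TL R d = 2^-1 *: (T - L).
  by apply/matrixP=> p a; rewrite !mxE; field.
have LB : L - half_TL R d = - (2^-1 *: (T - L)).
  by apply/matrixP=> p a; rewrite !mxE; field.
have ZTL : (2^-1 *: (T - L))^T *m half_TL R d = 0.
  rewrite [(_ *: _)^T]linearZ /= [(_ - _)^T]linearB /= -scalemxAl.
  rewrite -scalemxAr mulmxBl !mulmxDr Lt_T Lt_L.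
  by rewrite [X in _ - X]addrC subrr !scaler0.
have BTL : (2^-1 *: (T - L))^T *m B = 0.
  rewrite -[LHS]trmxK trmx_mul trmxK -scalemxAr mulmxBr.
  by rewrite Bt_Tmat Bt_Lmat // subrr scaler0 trmx0.
rewrite Cphi_half_TL (info_orthogonal k0 (Bmat_gram _ _ _)) ?Bt_half_TL //.
  by rewrite TB LB tr_row_mx mul_col_mx linearN /= mulNmx ZTL oppr0 col_mx0.
by rewrite TB LB tr_row_mx mul_col_mx linearN /= mulNmx BTL oppr0 col_mx0.
Qed.

Lemma Cphi_CNBD_symmetric s : perm_conj s (Cphi R d) = Cphi R d.
Proof.
suff [x [y ->]] : exists x y : R, Cphi R d = x%:M + const_mx y.
  by apply/matrixP=> i j; rewrite !mxE (inj_eq perm_inj).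
have [r [TT _]] := Tt_T_scalar; have [x [y NN]] := incidence_gram.
rewrite Cphi_CNBD NN /half_TL [(_ *: _)^T]linearZ /= [(_ + _)^T]linearD /=.
rewrite -scalemxAl -scalemxAr.
rewrite mulmxDl !mulmxDr Lt_T Lt_L TT Tt_L.
(* The four products T'T, T'L, L'T, L'L add up to 2 (r - l) I + 2 l J, with J all ones; the two
   halves come from [half_TL]. *)
exists (2^-1 * (2^-1 * (2 * (r - l%:R))) - k%:R^-1 * x),
  (2^-1 * (2^-1 * (2 * l%:R)) - k%:R^-1 * y).
apply/matrixP=> i j; rewrite !mxE.
by case: (i == j); rewrite ?mulr1n ?mulr0n; field; rewrite pnatr_eq0 -lt0n.
Qed.

(** The general trace bound is attained because binary counts satisfy n^2 = n. *)
Lemma mxtrace_CNBD : \tr (Cphi R d) = (b * k)%:R / 2 - k%:R^-1 * (b * k)%:R.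
Proof.
rewrite Cphi_CNBD raddfB /= mxtraceZ mxtrace_half_TL //; last exact: CNBD_no_self_neighbor.
rewrite mxtrace_gram -(sum_incidence R d); congr (_ - _ * _).
by apply: eq_bigr => i _; apply: eq_bigr => a _; rewrite incidence_idem.
Qed.

End NeighborBalanced.

Theorem theorem6 (R : realType) (t b k : nat) (dstar : design t b k) :
  (0 < b)%N -> (3 <= k)%N -> (k <= t)%N -> (t * (t - 1) %| b * k)%N ->
  CNBD ((b * k) %/ (t * (t - 1))) dstar ->
  universally_optimal (@Cphi R t b k)
    (fun d : design t b k => circular d /\ no_self_neighbor d) dstar.
Proof.
move=> _ k3 kt _ dC Phi KPhi d [dc dn].
have k1 : (1 < k)%N by apply: ltnW.
have k0 := ltnW k1.
apply: (kiefer_le KPhi); first exact: leq_trans kt.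
- exact: nnd_Cphi.
- exact: Cphi_zero_row_sums.
- exact: Cphi_zero_row_sums.
- by move=> s; apply: Cphi_CNBD_symmetric dC s.
- by rewrite (mxtrace_CNBD R k1 dC) mxtrace_Cphi_le.
Qed.
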